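(* Let $(\mathcal{C},J)$, $(\mathcal{D},K)$ be coalgebras for the comonad $(\mathbb{S},\pi,\delta)$ on $\mathbf{Cat}$ and $f:\mathcal{C}\to\mathcal{D}$ a functor. Then: (1) $f$ supports a structure of lax morphism of coalgebras if and only if it is cover-preserving; (2) $f$ supports a structure of colax morphism of coalgebras if and only if it is cover-reflecting (cover-lifting). This remains true if $(\mathcal{C},J)$, $(\mathcal{D},K)$ are coalgebras for the underlying copointed endo-2-functor $(\mathbb{S},\pi)$.
   Context: A sieve on an object $c$ of $\mathcal{C}$ is a set of arrows with codomain $c$ closed under precomposition; sieves on $c$ are ordered by inclusion. For $u:b\to c$ and a sieve $S$ on $c$, $u^*S=\{v\mid uv\in S\}$. For a functor $f$ and a sieve $S$ on $c$, $\mathrm{lext}_f(S)$ is the sieve on $f(c)$ generated by $\{f(u)\mid u\in S\}$. A filter on $c$ means a non-empty up-closed set of sieves on $c$ (closure under intersection is not required). For a filter $F$ on $c$: $u^*[F]$ is the filter generated (by up-closure) by $\{u^*S\mid S\in F\}$, and $\mathrm{lext}_f[F]$ the filter generated by $\{\mathrm{lext}_f(S)\mid S\in F\}$. $\mathbb{S}\mathcal{C}$ has as objects pairs $(c,F)$ with $F$ a filter on $c$; a morphism $(c,F)\to(c',F')$ is $u:c\to c'$ in $\mathcal{C}$ such that $u^*R\in F$ for all $R\in F'$. $\mathbb{S}f$ sends $(c,F)$ to $(f(c),\mathrm{lext}_f[F])$; $\mathbb{S}\phi$ has component $\phi_c$ at $(c,F)$. Counit: $\pi_{\mathcal{C}}:(c,F)\mapsto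 c$. Comultiplication: $\delta_{\mathcal{C}}:\mathbb{S}\mathcal{C}\to\mathbb{S}\mathbb{S}\mathcal{C}$, $(c,F)\mapsto(c,F,\mathcal{F}_{(c,F)})$, where $\mathcal{F}_{(c,F)}$ is the filter on $(c,F)$ generated by the sieves $\mathcal{R}_{(S,F)}$, $S\in F$, with $\mathcal{R}_{(S,F)}$ generated by the arrows $u:(b,u^*[F])\to(c,F)$ for $u:b\to c$ in $S$. A coalgebra for $(\mathbb{S},\pi)$ is a functor $J:\mathcal{C}\to\mathbb{S}\mathcal{C}$ with $\pi_{\mathcal{C}}J=1_{\mathcal{C}}$; we also write $J(c)$ for its filter of sieves on $c$, whose elements are called $J$-covering. A (strict) coalgebra for $(\mathbb{S},\pi,\delta)$ satisfies moreover $\delta_{\mathcal{C}}J=(\mathbb{S}J)J$. A lax (resp. colax) morphism $(\mathcal{C},J)\to(\mathcal{D},K)$ of coalgebras for $(\mathbb{S},\pi)$ is a functor $f:\mathcal{C}\to\mathcal{D}$ with a 2-cell $\phi:Kf\Rightarrow(\mathbb{S}f)J$ (resp. $\phi:(\mathbb{S}f)J\Rightarrow Kf$) such that the whiskering $\pi_{\mathcal{D}}\phi$ is the identity of $f$. A lax (resp. colax) morphism of coalgebras for the comonad is one satisfying moreover the equality of pastings $(\mathbb{S}\phi\cdot J)\circ(\mathbb{S}K\cdot\phi)=\delta_{\mathcal{D}}\cdot\phi$ of 2-cells $\delta_{\mathcal{D}}Kf\Rightarrow\delta_{\mathcal{D}}(\mathbb{S}f)J$ (resp. the dual equality). $f$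 is cover-preserving if $\mathrm{lext}_f(S)\in K(f(c))$ for all $c$ and $S\in J(c)$. $f$ is cover-reflecting (cover-lifting) if for all $c$ and $R\in K(f(c))$ the sieve $\{u:c'\to c\mid f(u)\in R\}$ is in $J(c)$ (equivalently, $R\supseteq\mathrm{lext}_f(S)$ for some $S\in J(c)$).
   Formalization: δ is not strictly natural for filters not closed under intersection, so the two pastings need not be parallel; the lax and colax equations are stated with the canonical 2-cell (SSf)δ_C ⇒ δ_D(Sf) inserted, which is the identity whenever its boundaries agree. *)

(* Defs.v *)
From Stdlib Require Import FunctionalExtensionality PropExtensionality
  ProofIrrelevance.

Set Implicit Arguments.
Unset Strict Implicit.
Unset Printing Implicit Defensive.

Declare Scope cat_scope.
Delimit Scope cat_scope with cat.
Open Scope cat_scope.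

Reserved Notation "g \o f" (at level 50, left associativity).
Reserved Notation "G \O F" (at level 50, left associativity).
Reserved Notation "F ==> G" (at level 70, no associativity).
Reserved Notation "H <| a" (at level 48, right associativity).
Reserved Notation "a |> H" (at level 47, left associativity).
Reserved Notation "S <== T" (at level 70, no associativity).

Record category := Category {
  ob :> Type;
  hom : ob -> ob -> Type;
  idm : forall a, hom a a;
  comp : forall a b c, hom b c -> hom a b -> hom a c;
  comp_idl : forall a b (u : hom a b), comp (idm b) u = u;
  comp_idr : forall a b (u : hom a b), comp u (idm a) = u;
  comp_assoc : forall a b c d (w : hom c d) (v : hom b c) (u : hom a b),
    comp w (comp v u) = comp (comp w v) u
}.
Arguments hom {C} _ _ : rename.
Arguments idm {C} _ : rename.

Notation "g \o f" := (comp g f) : cat_scope.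

Record functor (C D : category) := Functor {
  fob :> C -> D;
  fmap : forall a b : C, hom a b -> hom (fob a) (fob b);
  fmap_id : forall a : C, fmap (idm a) = idm (fob a);
  fmap_comp : forall (a b c : C) (v : hom b c) (u : hom a b),
    fmap (v \o u) = fmap v \o fmap u
}.
Arguments fmap {C D} _ {a b} _.

Definition fun_id (C : category) : functor C C :=
  {| fob := fun c => c;
     fmap := fun _ _ u => u;
     fmap_id := fun _ => eq_refl;
     fmap_comp := fun _ _ _ _ _ => eq_refl |}.

Program Definition fun_comp (C D E : category)
    (G : functor D E) (F : functor C D) : functor C E :=
  {| fob := fun c => G (F c); fmap := fun _ _ u => fmap G (fmap F u) |}.
Next Obligation. now rewrite !fmap_id. Qed.
Next Obligation. now rewrite !fmap_comp. Qed.

Notation "G \O F" := (fun_comp G F) : cat_scope.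

Record nat_trans (C D : category) (F G : functor C D) := NatTrans {
  cpt :> forall c : C, hom (F c) (G c);
  naturality : forall (b c : C) (u : hom b c),
    cpt c \o fmap F u = fmap G u \o cpt b
}.

Notation "F ==> G" := (nat_trans F G) : cat_scope.

Program Definition nat_id (C D : category) (F : functor C D) : F ==> F :=
  {| cpt := fun c => idm (F c) |}.
Next Obligation. now rewrite comp_idl, comp_idr. Qed.

Program Definition vcomp (C D : category) (F G H : functor C D)
    (b : G ==> H) (a : F ==> G) : F ==> H :=
  {| cpt := fun c => b c \o a c |}.
Next Obligation.
now rewrite <- comp_assoc, naturality, comp_assoc, naturality, comp_assoc.
Qed.

Program Definition whiskerl (C D E : category) (H : functor D E)
    (F G : functor C D) (a : F ==> G) : H \O F ==> H \O G :=
  {| cpt := fun c => fmap H (a c) |}.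
Next Obligation. now rewrite <- !fmap_comp, naturality. Qed.

Program Definition whiskerr (B C D : category) (F G : functor C D)
    (a : F ==> G) (H : functor B C) : F \O H ==> G \O H :=
  {| cpt := fun b => a (H b) |}.
Next Obligation. apply naturality. Qed.

Notation "H <| a" := (whiskerl H a) : cat_scope.
Notation "a |> H" := (whiskerr a H) : cat_scope.

(** Cat is strict: functors are compared with Leibniz equality.  An equation
    between functors gives an identity 2-cell, and [vcomp_along p b a] is the
    pasting of [a] and [b] along the common functor [G = G'] that [p] provides. *)

Definition nat_eq (C D : category) (F G : functor C D) (p : F = G) : F ==> G :=
  match p with eq_refl => nat_id F end.

Definition vcomp_along (C D : category) (F G G' H : functor C D) (p : G = G')
    (b : G' ==> H) (a : F ==> G) : F ==> H :=
  vcomp b (vcomp (nat_eq p) a).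

(** 2-cells of Cat together with their boundary: equality in this type says
    that the boundaries agree and that the 2-cells agree. *)
Record cell (C D : category) := Cell {
  cell_src : functor C D;
  cell_tgt : functor C D;
  cell_nat : cell_src ==> cell_tgt
}.
Arguments Cell {C D cell_src cell_tgt} _.

Definition hom_cast (C : category) (a b a' b' : C) (p : a = a') (q : b = b')
    (u : hom a b) : hom a' b' :=
  eq_rect b (hom a') (eq_rect a (fun x => hom x b) u a' p) b' q.

Lemma functor_ext (C D : category) (F G : functor C D)
    (p : forall c, F c = G c) :
  (forall b c (u : hom b c), hom_cast (p b) (p c) (fmap F u) = fmap G u) ->
  F = G.
Proof.
destruct F as [F0 F1 Fi Fc], G as [G0 G1 Gi Gc]; simpl in *.
assert (E : F0 = G0) by (apply functional_extensionality; exact p).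
subst G0; intros H.
assert (E : F1 = G1).
{ do 3 (apply functional_extensionality_dep; intro).
  rewrite <- H.
  now rewrite (proof_irrelevance _ (p x) eq_refl),
    (proof_irrelevance _ (p x0) eq_refl). }
subst G1; f_equal; apply proof_irrelevance.
Qed.

Lemma fun_comp_assoc (A B C D : category)
    (H : functor C D) (G : functor B C) (F : functor A B) :
  H \O (G \O F) = (H \O G) \O F.
Proof. now apply (@functor_ext A D (H \O (G \O F)) ((H \O G) \O F) (fun _ => eq_refl)). Qed.

Record sieve (C : category) (c : C) := Sieve {
  arr : forall b : C, hom b c -> Prop;
  arr_comp : forall (a b : C) (u : hom b c) (v : hom a b),
    arr u -> arr (u \o v)
}.
Arguments arr {C c} _ {b} _.

Definition sub_sieve (C : category) (c : C) (S T : sieve c) : Prop :=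
  forall (b : C) (u : hom b c), arr S u -> arr T u.

Notation "S <== T" := (sub_sieve S T) : cat_scope.

Program Definition sieve_gen (C : category) (c : C)
    (P : forall b : C, hom b c -> Prop) : sieve c :=
  {| arr := fun a w => exists (b : C) (u : hom b c) (v : hom a b),
       P b u /\ w = u \o v |}.
Next Obligation.
match goal with H : P _ _ |- _ => rename H into HP end.
do 3 eexists; split; [exact HP | symmetry; apply comp_assoc].
Qed.

Program Definition pullback (C : category) (b c : C) (u : hom b c)
    (S : sieve c) : sieve b :=
  {| arr := fun _ v => arr S (u \o v) |}.
Next Obligation. rewrite comp_assoc; now apply arr_comp. Qed.

Inductive image_arrows (C D : category) (f : functor C D) (c : C)
    (S : sieve c) : forall d : D, hom d (f c) -> Prop :=
  ImageArrow (b : C) (u : hom b c) : arr S u -> image_arrows S (fmap f u).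

Definition lext (C D : category) (f : functor C D) (c : C) (S : sieve c) :
    sieve (f c) :=
  sieve_gen (@image_arrows C D f c S).

Program Definition preimage (C D : category) (f : functor C D) (c : C)
    (R : sieve (f c)) : sieve c :=
  {| arr := fun _ u => arr R (fmap f u) |}.
Next Obligation. rewrite fmap_comp; now apply arr_comp. Qed.
Arguments preimage {C D} f {c} R.

(** Closure under intersection is deliberately not required. *)
Record filter (C : category) (c : C) := Filter {
  covers :> sieve c -> Prop;
  filter_nonempty : exists S, covers S;
  filter_up : forall S T : sieve c, S <== T -> covers S -> covers T
}.

Program Definition filter_gen (C : category) (c : C) (I : Type)
    (P : I -> Prop) (B : I -> sieve c) (ne : exists i, P i) : filter c :=
  {| covers := fun T => exists i, P i /\ B i <== T |}.
Next Obligation. exists (B ne); exists ne; split; [assumption | now intros ? ?]. Qed.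
Next Obligation.
match goal with HP : P ?i |- _ => exists i; split; [exact HP |] end.
intros b u Hu; auto.
Qed.

Definition pullback_filter (C : category) (b c : C) (u : hom b c)
    (F : filter c) : filter b :=
  filter_gen (pullback u) (filter_nonempty F).

Definition lext_filter (C D : category) (f : functor C D) (c : C)
    (F : filter c) : filter (f c) :=
  filter_gen (@lext C D f c) (filter_nonempty F).

Lemma sieve_ext (C : category) (c : C) (S T : sieve c) :
  S <== T -> T <== S -> S = T.
Proof.
destruct S as [S HS], T as [T HT]; unfold sub_sieve; simpl; intros H1 H2.
assert (E : S = T).
{ apply functional_extensionality_dep; intro b.
  apply functional_extensionality; intro u.
  apply propositional_extensionality; split; auto. }
subst T; f_equal; apply proof_irrelevance.
Qed.

Lemma filter_ext (C : category) (c : C) (F G : filter c) :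
  (forall S, F S <-> G S) -> F = G.
Proof.
destruct F as [F F1 F2], G as [G G1 G2]; simpl; intros H.
assert (E : F = G).
{ apply functional_extensionality; intro S.
  apply propositional_extensionality, H. }
subst G; f_equal; apply proof_irrelevance.
Qed.

Record sob (C : category) := Sob { base : C; filt : filter base }.
Arguments Sob {C} base filt.

Record shom (C : category) (x y : sob C) := Shom {
  under : hom (base x) (base y);
  under_covers : forall R : sieve (base y),
    filt y R -> filt x (pullback under R)
}.

Lemma shom_ext (C : category) (x y : sob C) (u v : shom x y) :
  under u = under v -> u = v.
Proof.
destruct u as [u Hu], v as [v Hv]; simpl; intros E; subst v.
f_equal; apply proof_irrelevance.
Qed.

Program Definition shom_id (C : category) (x : sob C) : shom x x :=
  {| under := idm (base x) |}.
Next Obligation.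
eapply filter_up; [| eassumption].
intros b u Hu; simpl; now rewrite comp_idl.
Qed.

Program Definition shom_comp (C : category) (x y z : sob C)
    (v : shom y z) (u : shom x y) : shom x z :=
  {| under := under v \o under u |}.
Next Obligation.
match goal with H : covers _ _ |- _ =>
  apply (under_covers v), (under_covers u) in H; revert H end.
apply filter_up; intros b w Hw; simpl in *; now rewrite <- comp_assoc.
Qed.

Program Definition Scat (C : category) : category :=
  {| ob := sob C; hom := @shom C; idm := @shom_id C; comp := @shom_comp C |}.
Next Obligation. apply shom_ext, comp_idl. Qed.
Next Obligation. apply shom_ext, comp_idr. Qed.
Next Obligation. apply shom_ext, comp_assoc. Qed.

Program Definition Smap (C D : category) (f : functor C D) (x y : sob C)
    (u : shom x y) :
    shom (Sob (f (base x)) (lext_filter f (filt x)))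
         (Sob (f (base y)) (lext_filter f (filt y))) :=
  {| under := fmap f (under u) |}.
Next Obligation.
match goal with H : covers (filt y) ?S, HR : _ <== R |- _ =>
  exists (pullback (under u) S); split; [now apply under_covers |];
  intros a w [d [g [v [Hg ->]]]]; simpl; apply HR; destruct Hg as [b u' Hu'];
  exists (f b), (fmap f (under u \o u')), v; split
end.
- now constructor.
- now rewrite fmap_comp, comp_assoc.
Qed.

Program Definition Sfun (C D : category) (f : functor C D) :
    functor (Scat C) (Scat D) :=
  {| fob := fun x : Scat C =>
       Sob (f (base x)) (lext_filter f (filt x)) : Scat D;
     fmap := fun x y (u : @hom (Scat C) x y) => Smap f u |}.
Next Obligation. apply shom_ext, fmap_id. Qed.
Next Obligation. apply shom_ext, fmap_comp. Qed.

Program Definition Snat_cpt (C D : category) (f g : functor C D)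
    (phi : f ==> g) (x : Scat C) : @hom (Scat D) (Sfun f x) (Sfun g x) :=
  {| under := phi (base x) |}.
Next Obligation.
match goal with H : covers (filt x) ?S, HR : _ <== R |- _ =>
  exists S; split; [exact H |];
  intros a w [d [h [v [Hh ->]]]]; simpl; apply HR; destruct Hh as [b u' Hu'];
  exists (g b), (fmap g u'), (phi b \o v); split
end.
- now constructor.
- now rewrite !comp_assoc, naturality.
Qed.

Program Definition Snat (C D : category) (f g : functor C D) (phi : f ==> g) :
    Sfun f ==> Sfun g :=
  {| cpt := Snat_cpt phi |}.
Next Obligation. apply shom_ext, naturality. Qed.

Lemma under_cast (C : category) (b c : C) (F F' : filter b) (G G' : filter c)
    (p : F = F') (q : G = G') (u : @hom (Scat C) (Sob b F) (Sob c G)) :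
  under (hom_cast (C := Scat C) (f_equal (Sob b) p) (f_equal (Sob c) q) u)
  = under u.
Proof. now destruct p, q. Qed.

Lemma lext_filter_comp (C D E : category) (g : functor D E) (f : functor C D)
    (c : C) (F : filter c) :
  lext_filter (g \O f) F = lext_filter g (lext_filter f F).
Proof.
assert (key : forall S : sieve c, lext (g \O f) S = lext g (lext f S)).
{ intro S; apply sieve_ext.
  - intros a w [d [h [v [Hh ->]]]]; destruct Hh as [b u Hu].
    exists (g (f b)), (fmap g (fmap f u)), v; split; [| reflexivity].
    constructor; exists (f b), (fmap f u), (idm _); split.
    + now constructor.
    + now rewrite comp_idr.
  - intros a w [d [h [v [Hh ->]]]]; destruct Hh as [b u Hu].
    destruct Hu as [d' [h' [v' [Hh' ->]]]]; destruct Hh' as [b' u' Hu'].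
    exists (g (f b')), (fmap g (fmap f u')), (fmap g v' \o v); split.
    + now apply (@ImageArrow _ _ (g \O f)).
    + now rewrite fmap_comp, comp_assoc. }
apply filter_ext; intro T; split.
- intros [S [HS HT]]; exists (lext f S); split.
  + exists S; split; [exact HS | now intros ? ?].
  + now rewrite <- key.
- intros [S' [[S [HS HS']] HT]]; exists S; split; [exact HS |].
  rewrite key; intros a w [d [h [v [Hh ->]]]]; apply HT.
  destruct Hh as [b u Hu].
  exists (g b), (fmap g u), v; split; [| reflexivity].
  constructor; auto.
Qed.

Lemma Sfun_comp (C D E : category) (g : functor D E) (f : functor C D) :
  Sfun (g \O f) = Sfun g \O Sfun f.
Proof.
apply (@functor_ext _ _ (Sfun (g \O f)) (Sfun g \O Sfun f)
  (fun x => f_equal (Sob (g (f (base x)))) (lext_filter_comp g f (filt x)))).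
intros x y u; apply shom_ext; simpl.
exact (under_cast (lext_filter_comp g f (filt x))
         (lext_filter_comp g f (filt y)) (fmap (Sfun (g \O f)) u)).
Qed.

Definition pi (C : category) : functor (Scat C) C :=
  {| fob := fun x : Scat C => base x;
     fmap := fun _ _ u => under u;
     fmap_id := fun _ => eq_refl;
     fmap_comp := fun _ _ _ _ _ => eq_refl |}.

(** For [x = (c, F)], the arrow [u : (b, u^* [F]) -> (c, F)]. *)
Program Definition lift (C : category) (x : Scat C) (b : C)
    (u : hom b (base x)) :
    @hom (Scat C) (Sob b (pullback_filter u (filt x))) x :=
  {| under := u |}.
Next Obligation. exists R; split; [assumption | now intros ? ?]. Qed.
Arguments lift {C} x {b} u.

Inductive lifts (C : category) (x : Scat C) (S : sieve (base x)) :
    forall y : Scat C, hom y x -> Prop :=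
  Lift (b : C) (u : hom b (base x)) : arr S u -> lifts S (lift x u).

Definition lift_sieve (C : category) (x : Scat C) (S : sieve (base x)) :
    sieve x :=
  sieve_gen (lifts S).

Definition lift_filter (C : category) (x : Scat C) : filter x :=
  filter_gen (@lift_sieve C x) (filter_nonempty (filt x)).

Lemma delta_map_covers (C : category) (x y : Scat C) (u : hom x y)
    (R : sieve y) : lift_filter y R -> lift_filter x (pullback u R).
Proof.
intros [S [HS HR]].
exists (pullback (under u) S); split; [now apply (under_covers u) |].
intros a w [z [h [v [Hh ->]]]]; simpl; apply HR; destruct Hh as [b t Ht].
assert (Hk : forall R0 : sieve b,
  pullback_filter (under u \o t) (filt y) R0 ->
  pullback_filter t (filt x) (pullback (idm b) R0)).
{ intros R0 [T [HT HTR]]; exists (pullback (under u) T); split.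
  - now apply (under_covers u).
  - intros d r Hr; simpl in *; rewrite comp_idl.
    now apply HTR; simpl; rewrite <- comp_assoc. }
pose (k := Shom (x := Sob b (pullback_filter t (filt x)))
  (y := Sob b (pullback_filter (under u \o t) (filt y))) Hk).
exists (Sob b (pullback_filter (under u \o t) (filt y))),
  (lift y (under u \o t)), (shom_comp k v); split.
- now constructor.
- apply shom_ext; simpl.
  now rewrite comp_idl, comp_assoc.
Qed.

Definition delta_map (C : category) (x y : Scat C) (u : hom x y) :
    @hom (Scat (Scat C)) (Sob x (lift_filter x)) (Sob y (lift_filter y)) :=
  @Shom (Scat C) (Sob x (lift_filter x)) (Sob y (lift_filter y)) u
    (delta_map_covers u).

Program Definition delta (C : category) : functor (Scat C) (Scat (Scat C)) :=
  {| fob := fun x : Scat C => Sob x (lift_filter x) : Scat (Scat C);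
     fmap := fun x y (u : @hom (Scat C) x y) => delta_map u |}.
Next Obligation. now apply shom_ext. Qed.
Next Obligation. now apply shom_ext. Qed.

Lemma delta_cell_covers (C D : category) (f : functor C D) (x : Scat C)
    (R : sieve (Sfun f x)) :
  lift_filter (Sfun f x) R ->
  lext_filter (Sfun f) (lift_filter x) (pullback (idm (Sfun f x)) R).
Proof.
intros [T [[S [HS HT]] HR]].
exists (lift_sieve S); split.
{ exists S; split; [exact HS | now intros ? ?]. }
intros a w [z [h [v [Hh ->]]]]; simpl; apply HR.
destruct Hh as [y h [z [h' [k [Hh' ->]]]]]; destruct Hh' as [b u Hu].
set (F := filt x) in *.
assert (Hm : forall R0 : sieve (f b),
  pullback_filter (fmap f u) (lext_filter f F) R0 ->
  lext_filter f (pullback_filter u F) (pullback (idm (f b)) R0)).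
{ intros R0 [T0 [[S0 [HS0 HT0]] HR0]]; exists (pullback u S0); split.
  - exists S0; split; [exact HS0 | now intros ? ?].
  - intros d r [d' [g [r' [Hg ->]]]]; simpl; rewrite comp_idl; apply HR0; simpl.
    destruct Hg as [e t Ht]; apply HT0.
    exists (f e), (fmap f (u \o t)), r'; split.
    + now constructor.
    + now rewrite fmap_comp, comp_assoc. }
pose (m := Shom (x := Sob (f b) (lext_filter f (pullback_filter u F)))
  (y := Sob (f b) (pullback_filter (fmap f u) (lext_filter f F))) Hm).
exists (Sob (f b) (pullback_filter (fmap f u) (lext_filter f F))),
  (lift (Sfun f x) (fmap f u)), (shom_comp m (shom_comp (Smap f k) v)).
split.
- constructor; apply HT.
  exists (f b), (fmap f u), (idm (f b)); split.
  + now constructor.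
  + now rewrite comp_idr.
- apply shom_ext; simpl.
  now rewrite !comp_idl, fmap_comp, comp_assoc.
Qed.

(** The naturality cell of [delta] at [f].  Its components are identities on
    underlying objects, but its boundary functors need not coincide: if
    [F] is generated by [{u}] and [{v}] for a cospan [u : b -> c <- a : v] and
    [f] adjoins a commutative square over it, then [lext_f [u^* [F]]] contains
    the empty sieve while [(f u)^* [lext_f [F]]] does not, and
    [Sfun (Sfun f) (delta (c, F))] and [delta (Sfun f (c, F))] carry different
    filters.  When the boundaries coincide, this is the identity cell
    (lemma [delta_cell_strict]). *)
Definition delta_cell_cpt (C D : category) (f : functor C D)
    (x : Scat C) :
    hom ((Sfun (Sfun f) \O delta C) x) ((delta D \O Sfun f) x) :=
  @Shom (Scat D) ((Sfun (Sfun f) \O delta C) x) ((delta D \O Sfun f) x)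
    (idm (Sfun f x)) (@delta_cell_covers C D f x).

Program Definition delta_cell (C D : category) (f : functor C D) :
    Sfun (Sfun f) \O delta C ==> delta D \O Sfun f :=
  {| cpt := delta_cell_cpt f |}.
Next Obligation.
apply shom_ext, shom_ext; simpl; now rewrite comp_idl, comp_idr.
Qed.

Lemma cpt_nat_eq (C D : category) (F G : functor C D) (p : F = G) (c : C) :
  nat_eq p c
  = hom_cast eq_refl (f_equal (fun H : functor C D => H c) p) (idm (F c)).
Proof. now destruct p. Qed.

Lemma under_cast_id (C : category) (x y : Scat C) (p : x = y) :
  under (hom_cast eq_refl p (idm x))
  = hom_cast eq_refl (f_equal (@base C) p) (idm (base x)).
Proof. now destruct p. Qed.

Lemma nat_trans_ext (C D : category) (F G : functor C D) (a b : F ==> G) :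
  (forall c, a c = b c) -> a = b.
Proof.
destruct a as [a Ha], b as [b Hb]; simpl; intros H.
assert (E : a = b) by (apply functional_extensionality_dep; exact H).
subst b; f_equal; apply proof_irrelevance.
Qed.

Lemma delta_cell_strict (C D : category) (f : functor C D)
    (p : Sfun (Sfun f) \O delta C = delta D \O Sfun f) :
  delta_cell f = nat_eq p.
Proof.
apply nat_trans_ext; intro x; rewrite cpt_nat_eq.
apply shom_ext; rewrite under_cast_id; simpl.
match goal with |- _ = hom_cast _ ?q _ =>
  now rewrite (proof_irrelevance _ q eq_refl)
end.
Qed.

Record copointed_coalgebra (C : category) := CopointedCoalgebra {
  struct_map :> functor C (Scat C);
  struct_counit : pi C \O struct_map = fun_id C
}.

Record coalgebra (C : category) := Coalgebra {
  coalgebra_copointed :> copointed_coalgebra C;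
  coalgebra_coassoc :
    delta C \O coalgebra_copointed
    = Sfun coalgebra_copointed \O coalgebra_copointed
}.

(** [J c] is a pair whose first component is only propositionally equal to [c];
    its filter is transported to [c]. *)
Definition covering (C : category) (J : copointed_coalgebra C) (c : C) :
    filter c :=
  eq_rect (base (J c)) (@filter C) (filt (J c)) c
    (f_equal (fun H : functor C C => H c) (struct_counit J)).

Definition cover_preserving (C D : category) (J : copointed_coalgebra C)
    (K : copointed_coalgebra D) (f : functor C D) : Prop :=
  forall (c : C) (S : sieve c), covering J c S -> covering K (f c) (lext f S).

Definition cover_reflecting (C D : category) (J : copointed_coalgebra C)
    (K : copointed_coalgebra D) (f : functor C D) : Prop :=
  forall (c : C) (R : sieve (f c)),
    covering K (f c) R -> covering J c (preimage f R).

Definition copointed_lax_morphism (C D : category)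
    (J : copointed_coalgebra C) (K : copointed_coalgebra D) (f : functor C D)
    (phi : K \O f ==> Sfun f \O J) : Prop :=
  Cell (pi D <| phi) = Cell (nat_id f).

Definition copointed_colax_morphism (C D : category)
    (J : copointed_coalgebra C) (K : copointed_coalgebra D) (f : functor C D)
    (phi : Sfun f \O J ==> K \O f) : Prop :=
  Cell (pi D <| phi) = Cell (nat_id f).

Lemma Sfun_mid (C D : category) (J : copointed_coalgebra C)
    (K : copointed_coalgebra D) (f : functor C D) :
  Sfun K \O (Sfun f \O J) = Sfun (K \O f) \O J.
Proof. now rewrite Sfun_comp, fun_comp_assoc. Qed.

Lemma Sfun_coassoc (C D : category) (J : coalgebra C) (f : functor C D) :
  Sfun (Sfun f \O J) \O J = (Sfun (Sfun f) \O delta C) \O J.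
Proof.
now rewrite Sfun_comp, <- !fun_comp_assoc, coalgebra_coassoc.
Qed.

(** The pasting
    [(Sfun K) K f ==> (Sfun K) (Sfun f) J = Sfun (K f) J ==> Sfun ((Sfun f) J) J
     = (Sfun (Sfun f)) delta J ==> delta (Sfun f) J]
    is compared with [delta <| phi : delta K f ==> delta (Sfun f) J]. *)
Definition lax_morphism (C D : category) (J : coalgebra C) (K : coalgebra D)
    (f : functor C D) (phi : K \O f ==> Sfun f \O J) : Prop :=
  copointed_lax_morphism phi /\
  Cell (vcomp_along (Sfun_coassoc J f) (delta_cell f |> J)
         (vcomp_along (Sfun_mid J K f) (Snat phi |> J) (Sfun K <| phi)))
  = Cell (delta D <| phi).

(** Dually, both sides are 2-cells
    [Sfun ((Sfun f) J) J = (Sfun (Sfun f)) delta J ==> (Sfun K) K f = delta K f]. *)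
Definition colax_morphism (C D : category) (J : coalgebra C) (K : coalgebra D)
    (f : functor C D) (phi : Sfun f \O J ==> K \O f) : Prop :=
  copointed_colax_morphism phi /\
  Cell (vcomp_along (eq_sym (Sfun_mid J K f)) (Sfun K <| phi) (Snat phi |> J))
  = Cell (vcomp_along (eq_sym (fun_comp_assoc (delta D) (Sfun f) J))
            (delta D <| phi) (delta_cell f |> J)).

(* Main.v *)
From Stdlib Require Import ProofIrrelevance.
Require Import Defs.

Set Implicit Arguments.
Unset Strict Implicit.
Unset Printing Implicit Defensive.

(** A 2-cell between functors into [Scat D] whose whiskering with [pi D] is the
    identity of [f] has components that are identities on underlying objects;
    such a component [(f c, F) -> (f c, G)] exists exactly when [G] is included
    in [F], and naturality is then automatic because [pi D] is faithful.  So a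
    2-cell [K \O f ==> Sfun f \O J] over the identity exists if and only if
    [lext_filter f (J c)] is included in [K (f c)] for every [c], which is
    preservation of covers; a 2-cell in the other direction exists if and only
    if [K (f c)] is included in [lext_filter f (J c)], which is reflection of
    covers since [lext f S <== R] means [S <== preimage f R].

    The comonad adds nothing to this: both sides of the pasting equation are
    2-cells into [Scat (Scat D)] with the same boundary, by coassociativity of
    [J] and [K].  Every 2-cell entering the pastings is an identity on
    underlying objects of [D], hence so are both sides.  As
    [pi D \O pi (Scat D)] is faithful, they are equal
    ([over_identity_unique], [lax_morphism_iff], [colax_morphism_iff]).

    The objects [base (J c)] and [c] are only propositionally equal.  To compare
    2-cells with covers without transports, every copointed coalgebra is
    replaced by one of the form [c |-> (c, F c)], where [F] is a family of
    filters stable under pullback ([copointed_coalgebra_stable_family]). *)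

(** * Transports along equalities of objects *)

Lemma hom_cast_refl (C : category) (a b : C) (p : a = a) (q : b = b)
    (u : hom a b) :
  hom_cast p q u = u.
Proof.
now rewrite (proof_irrelevance _ p eq_refl), (proof_irrelevance _ q eq_refl).
Qed.

Lemma under_hom_cast (C : category) (x y x' y' : Scat C) (p : x = x')
    (q : y = y') (u : hom x y) :
  under (hom_cast p q u)
  = hom_cast (f_equal (@base C) p) (f_equal (@base C) q) (under u).
Proof. now destruct p, q. Qed.

Lemma fmap_eq (C D : category) (F G : functor C D) (p : F = G) (a b : C)
    (u : hom a b) :
  hom_cast (f_equal (fun H : functor C D => H a) p)
    (f_equal (fun H : functor C D => H b) p) (fmap F u) = fmap G u.
Proof. now destruct p. Qed.

Lemma sob_eta (C : category) (x : sob C) (c : C) (p : base x = c) :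
  x = Sob c (eq_rect (base x) (@filter C) (filt x) c p).
Proof. now destruct p, x. Qed.

(** Eliminating an equation between whole cells gives the boundary equations
    that the components have to be transported along. *)
Lemma cell_eq_iff (C D : category) (x y : cell C D) :
  x = y <->
  exists (p : cell_src x = cell_src y) (q : cell_tgt x = cell_tgt y),
    forall c, hom_cast (f_equal (fun H : functor C D => H c) p)
      (f_equal (fun H : functor C D => H c) q) (cell_nat x c) = cell_nat y c.
Proof.
split.
- intros E; destruct E; now exists eq_refl, eq_refl.
- destruct x as [F G a], y as [F' G' b]; simpl.
  intros [p [q H]]; destruct p, q; f_equal; exact (nat_trans_ext H).
Qed.

(** * Coalgebras as pullback-stable families of filters *)

Section StableFamily.

Variables (C : category) (F : forall c : C, filter c).

Definition pullback_stable : Prop :=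
  forall (b c : C) (u : hom b c) (R : sieve c), F c R -> F b (pullback u R).

Hypothesis HF : pullback_stable.

Program Definition stable_functor : functor C (Scat C) :=
  {| fob := fun c => Sob c (F c) : Scat C;
     fmap := fun b c u => @Shom C (Sob b (F b)) (Sob c (F c)) u (@HF b c u) |}.
Next Obligation. now apply shom_ext. Qed.
Next Obligation. now apply shom_ext. Qed.

End StableFamily.

(** A section [J] of [pi C] sends [u] to an arrow with underlying arrow [u], up
    to transport; that this is an arrow of [Scat C] is precisely the stability
    of the transported filters. *)
Lemma section_of_pi_stable (C : category) (J : functor C (Scat C)) :
  pi C \O J = fun_id C ->
  exists (F : forall c : C, filter c) (HF : pullback_stable F),
    J = stable_functor HF.
Proof.
intros E.
pose (p c := f_equal (fun H : functor C C => H c) E : base (J c) = c).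
pose (F c := eq_rect (base (J c)) (@filter C) (filt (J c)) c (p c)).
pose (q c := sob_eta (p c) : J c = Sob c (F c)).
assert (Hu : forall b c (u : hom b c),
  under (hom_cast (C := Scat C) (q b) (q c) (fmap J u)) = u).
{ intros b c u; rewrite under_hom_cast.
  transitivity (hom_cast (p b) (p c) (under (fmap J u))).
  - now f_equal; apply proof_irrelevance.
  - exact (fmap_eq E u). }
assert (HF : pullback_stable F).
{ intros b c u R HR.
  generalize (under_covers (hom_cast (C := Scat C) (q b) (q c) (fmap J u)) HR).
  now rewrite Hu. }
exists F, HF; apply (@functor_ext _ _ J (stable_functor HF) q).
intros b c u; apply shom_ext, Hu.
Qed.

(** An induction principle rather than an equation, because the types of the
    2-cells depend on the functor being replaced. *)
Lemma copointed_coalgebra_stable_family (C : category)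
    (P : copointed_coalgebra C -> Prop) :
  (forall (F : forall c : C, filter c) (HF : pullback_stable F)
     (E : pi C \O stable_functor HF = fun_id C), P (CopointedCoalgebra E)) ->
  forall J, P J.
Proof.
intros H [J E]; destruct (section_of_pi_stable E) as [F [HF ->]]; apply H.
Qed.

Lemma covering_stable (C : category) (F : forall c : C, filter c)
    (HF : pullback_stable F) (E : pi C \O stable_functor HF = fun_id C) (c : C) :
  covering (CopointedCoalgebra E) c = F c.
Proof.
unfold covering; simpl.
match goal with |- eq_rect _ _ _ _ ?p = _ =>
  now rewrite (proof_irrelevance _ p eq_refl)
end.
Qed.

(** * Coalgebra morphisms for the copointed endofunctor *)

Lemma lext_adjoint (C D : category) (f : functor C D) (c : C) (S : sieve c)
    (R : sieve (f c)) :
  lext f S <== R <-> S <== preimage f R.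
Proof.
split.
- intros H b u Hu; apply H.
  exists (f b), (fmap f u), (idm (f b)); split; [now constructor |].
  now rewrite comp_idr.
- intros H a w [d [g [v [Hg ->]]]]; destruct Hg as [b u Hu].
  now apply arr_comp, H.
Qed.

Lemma covers_pullback_id (C : category) (c : C) (F : filter c) (R : sieve c) :
  F (pullback (idm c) R) <-> F R.
Proof.
split; apply filter_up; intros b u; simpl; now rewrite comp_idl.
Qed.

Section Copointed.

Variables (C D : category) (f : functor C D).
Variables (F : forall c : C, filter c) (HF : pullback_stable F).
Variables (G : forall d : D, filter d) (HG : pullback_stable G).

Let J := stable_functor HF.
Let K := stable_functor HG.

Lemma pi_stable_src : pi D \O (K \O f) = f.
Proof.
now apply (@functor_ext _ _ (pi D \O (K \O f)) f (fun _ => eq_refl)).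
Qed.

Lemma pi_stable_tgt : pi D \O (Sfun f \O J) = f.
Proof.
now apply (@functor_ext _ _ (pi D \O (Sfun f \O J)) f (fun _ => eq_refl)).
Qed.

Lemma lax_over_id (phi : K \O f ==> Sfun f \O J) :
  Cell (pi D <| phi) = Cell (nat_id f) <->
  forall c, under (phi c) = idm (f c).
Proof.
rewrite cell_eq_iff; split.
- intros [p [q H]] c; exact (eq_trans (eq_sym (hom_cast_refl _ _ _)) (H c)).
- intros H; exists pi_stable_src, pi_stable_tgt; intros c.
  exact (eq_trans (hom_cast_refl _ _ _) (H c)).
Qed.

Lemma colax_over_id (phi : Sfun f \O J ==> K \O f) :
  Cell (pi D <| phi) = Cell (nat_id f) <->
  forall c, under (phi c) = idm (f c).
Proof.
rewrite cell_eq_iff; split.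
- intros [p [q H]] c; exact (eq_trans (eq_sym (hom_cast_refl _ _ _)) (H c)).
- intros H; exists pi_stable_tgt, pi_stable_src; intros c.
  exact (eq_trans (hom_cast_refl _ _ _) (H c)).
Qed.

Lemma lax_exists_iff :
  (exists phi : K \O f ==> Sfun f \O J, Cell (pi D <| phi) = Cell (nat_id f))
  <-> forall (c : C) (S : sieve c), F c S -> G (f c) (lext f S).
Proof.
split.
- intros [phi Hphi] c S HS; rewrite lax_over_id in Hphi.
  apply covers_pullback_id; rewrite <- (Hphi c).
  apply (under_covers (phi c)); exists S; split; [exact HS | now intros ? ?].
- intros H.
  assert (Hid : forall c R, lext_filter f (F c) R ->
    G (f c) (pullback (idm (f c)) R)).
  { intros c R [S [HS HR]]; apply covers_pullback_id.
    exact (filter_up HR (H c S HS)). }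
  unshelve eexists.
  + exists (fun c => @Shom D (Sob (f c) (G (f c)))
      (Sob (f c) (lext_filter f (F c))) (idm (f c)) (Hid c)).
    intros b c u; apply shom_ext; simpl; now rewrite comp_idl, comp_idr.
  + now apply lax_over_id.
Qed.

Lemma colax_exists_iff :
  (exists phi : Sfun f \O J ==> K \O f, Cell (pi D <| phi) = Cell (nat_id f))
  <-> forall (c : C) (R : sieve (f c)), G (f c) R -> F c (preimage f R).
Proof.
split.
- intros [phi Hphi] c R HR; rewrite colax_over_id in Hphi.
  generalize (under_covers (phi c) HR); rewrite (Hphi c); intros H.
  apply (covers_pullback_id (lext_filter f (F c)) R) in H.
  destruct H as [S [HS HSR]].
  exact (filter_up (proj1 (lext_adjoint S R) HSR) HS).
- intros H.
  assert (Hid : forall c R, G (f c) R ->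
    lext_filter f (F c) (pullback (idm (f c)) R)).
  { intros c R HR; apply covers_pullback_id.
    exists (preimage f R); split; [now apply H |].
    now apply lext_adjoint. }
  unshelve eexists.
  + exists (fun c => @Shom D (Sob (f c) (lext_filter f (F c)))
      (Sob (f c) (G (f c))) (idm (f c)) (Hid c)).
    intros b c u; apply shom_ext; simpl; now rewrite comp_idl, comp_idr.
  + now apply colax_over_id.
Qed.

End Copointed.

Lemma copointed_lax_iff (C D : category) (f : functor C D)
    (J : copointed_coalgebra C) (K : copointed_coalgebra D) :
  (exists phi : K \O f ==> Sfun f \O J, copointed_lax_morphism phi)
  <-> cover_preserving J K f.
Proof.
induction J as [F HF EJ] using copointed_coalgebra_stable_family.
induction K as [G HG EK] using copointed_coalgebra_stable_family.
unfold cover_preserving.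
setoid_rewrite covering_stable.
exact (lax_exists_iff f HF HG).
Qed.

Lemma copointed_colax_iff (C D : category) (f : functor C D)
    (J : copointed_coalgebra C) (K : copointed_coalgebra D) :
  (exists phi : Sfun f \O J ==> K \O f, copointed_colax_morphism phi)
  <-> cover_reflecting J K f.
Proof.
induction J as [F HF EJ] using copointed_coalgebra_stable_family.
induction K as [G HG EK] using copointed_coalgebra_stable_family.
unfold cover_reflecting.
setoid_rewrite covering_stable.
exact (colax_exists_iff f HF HG).
Qed.

(** * The comultiplication equation *)

(** The components concerned have sources and targets that are equal without
    being convertible, so being an identity is taken up to such an equality. *)
Definition is_identity (C : category) (a b : C) (u : hom a b) : Prop :=
  exists p : a = b, u = hom_cast eq_refl p (idm a).

Lemma is_identity_idm (C : category) (a : C) : is_identity (idm a).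
Proof. now exists eq_refl. Qed.

Lemma is_identity_comp (C : category) (a b c : C) (v : hom b c) (u : hom a b) :
  is_identity v -> is_identity u -> is_identity (v \o u).
Proof.
intros [q ->] [p ->]; destruct q, p; exists eq_refl; apply comp_idl.
Qed.

Lemma is_identity_fmap (C D : category) (F : functor C D) (a b : C)
    (u : hom a b) :
  is_identity u -> is_identity (fmap F u).
Proof. intros [p ->]; destruct p; exists eq_refl; apply fmap_id. Qed.

Lemma is_identity_unique (C : category) (a b : C) (u v : hom a b) :
  is_identity u -> is_identity v -> u = v.
Proof. intros [p ->] [q ->]; now rewrite (proof_irrelevance _ p q). Qed.

Lemma is_identity_hom_cast (C : category) (a b c : C) (p : a = c) (q : b = c)
    (u : hom a b) :
  hom_cast p q u = idm c -> is_identity u.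
Proof. destruct q, p; now exists eq_refl. Qed.

Lemma is_identity_of_cell (C D : category) (F G f : functor C D)
    (a : F ==> G) :
  Cell a = Cell (nat_id f) -> forall c, is_identity (a c).
Proof.
rewrite cell_eq_iff; intros [p [q H]] c; exact (is_identity_hom_cast (H c)).
Qed.

Definition over_identity (C D : category) (F G : functor C (Scat (Scat D)))
    (a : F ==> G) : Prop :=
  forall c, is_identity (under (under (a c))).

Lemma over_identity_vcomp_along (C D : category)
    (F G G' H : functor C (Scat (Scat D))) (p : G = G')
    (b : G' ==> H) (a : F ==> G) :
  over_identity b -> over_identity a -> over_identity (vcomp_along p b a).
Proof.
intros Hb Ha c; destruct p.
apply is_identity_comp; [apply Hb |].
apply is_identity_comp; [apply is_identity_idm | apply Ha].
Qed.

(** [pi D \O pi (Scat D)] is faithful, so 2-cells over identities are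
    determined by their boundary. *)
Lemma over_identity_unique (C D : category)
    (F G F' G' : functor C (Scat (Scat D))) (a : F ==> G) (b : F' ==> G') :
  F = F' -> G = G' -> over_identity a -> over_identity b -> Cell a = Cell b.
Proof.
intros p q Ha Hb; destruct p, q; f_equal.
apply nat_trans_ext; intros c; apply shom_ext, shom_ext.
now apply is_identity_unique.
Qed.

Section Pieces.

Variables (B C D : category) (F G : functor C (Scat D)) (phi : F ==> G).
Hypothesis Hphi : forall c, is_identity (under (phi c)).

Lemma over_identity_delta : over_identity (delta D <| phi).
Proof. exact Hphi. Qed.

Lemma over_identity_Snat (J : functor B (Scat C)) :
  over_identity (Snat phi |> J).
Proof. intros b; exact (Hphi (base (J b))). Qed.

Lemma over_identity_Sfun (E : category) (K : functor D (Scat E)) :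
  over_identity (Sfun K <| phi).
Proof. intros c; exact (is_identity_fmap (pi E \O K) (Hphi c)). Qed.

End Pieces.

Lemma over_identity_delta_cell (B C D : category) (f : functor C D)
    (J : functor B (Scat C)) :
  over_identity (delta_cell f |> J).
Proof. intros b; apply is_identity_idm. Qed.

Lemma delta_coalgebra_comp (C D : category) (K : coalgebra D)
    (f : functor C D) :
  delta D \O (K \O f) = Sfun K \O (K \O f).
Proof. now rewrite !fun_comp_assoc, coalgebra_coassoc. Qed.

Lemma lax_morphism_iff (C D : category) (J : coalgebra C) (K : coalgebra D)
    (f : functor C D) (phi : K \O f ==> Sfun f \O J) :
  lax_morphism phi <-> copointed_lax_morphism phi.
Proof.
split; [now intros [H _] | intros H; split; [exact H |]].
pose proof (is_identity_of_cell H) as Hphi.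
apply over_identity_unique.
- symmetry; apply delta_coalgebra_comp.
- symmetry; apply fun_comp_assoc.
- apply over_identity_vcomp_along; [apply over_identity_delta_cell |].
  apply over_identity_vcomp_along;
    [now apply over_identity_Snat | now apply over_identity_Sfun].
- now apply over_identity_delta.
Qed.

Lemma colax_morphism_iff (C D : category) (J : coalgebra C) (K : coalgebra D)
    (f : functor C D) (phi : Sfun f \O J ==> K \O f) :
  colax_morphism phi <-> copointed_colax_morphism phi.
Proof.
split; [now intros [H _] | intros H; split; [exact H |]].
pose proof (is_identity_of_cell H) as Hphi.
apply over_identity_unique.
- apply Sfun_coassoc.
- symmetry; apply delta_coalgebra_comp.
- apply over_identity_vcomp_along;
    [now apply over_identity_Sfun | now apply over_identity_Snat].
- apply over_identity_vcomp_along;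
    [now apply over_identity_delta | apply over_identity_delta_cell].
Qed.

(** * The characterization *)

Theorem proposition3p3p5 (C D : category) (f : functor C D) :
  (forall (J : coalgebra C) (K : coalgebra D),
     ((exists phi : K \O f ==> Sfun f \O J, lax_morphism phi)
        <-> cover_preserving J K f)
     /\
     ((exists phi : Sfun f \O J ==> K \O f, colax_morphism phi)
        <-> cover_reflecting J K f))
  /\
  (forall (J : copointed_coalgebra C) (K : copointed_coalgebra D),
     ((exists phi : K \O f ==> Sfun f \O J, copointed_lax_morphism phi)
        <-> cover_preserving J K f)
     /\
     ((exists phi : Sfun f \O J ==> K \O f, copointed_colax_morphism phi)
        <-> cover_reflecting J K f)).
Proof.
split; intros J K; split.
- setoid_rewrite lax_morphism_iff; apply copointed_lax_iff.
- setoid_rewrite colax_morphism_iff; apply copointed_colax_iff.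
- apply copointed_lax_iff.
- apply copointed_colax_iff.
Qed.
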